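(* Let $G=(\boldsymbol U\cup\boldsymbol X\cup\{Y\},E)$ be a binary linear model with hidden variables of the admissible form described in the context, and let $G'$ be the transformed Markovian model. For any $X\in\boldsymbol X\cup\{Y\}$, any $\boldsymbol S\subseteq\boldsymbol X$, any value $\mathrm{pa}'(X)\in\{0,1\}^{|\mathrm{Pa}'(X)|}$ (whose $X_1$-entry $x_1$ is $1$), and any $\boldsymbol s\in\{0,1\}^{|\boldsymbol S|}$ consistent with $\mathrm{pa}'(X)$ on $\boldsymbol S\cap \mathrm{Pa}'(X)$, such that the conditioning events have positive probability, $$\Pr\{X=1\mid \mathrm{Pa}'(X)\setminus\{X_1\}=\mathrm{pa}'(X)\setminus\{x_1\},\ do(\boldsymbol S=\boldsymbol s)\}=\Pr{}'\{X=1\mid \mathrm{Pa}'(X)=\mathrm{pa}'(X),\ do(\boldsymbol S=\boldsymbol s)\},$$ where $\Pr$ and $\Pr'$ denote probabilities in $G$ and $G'$ respectively.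
   Context: **BLM with hidden variables.** $G=(\boldsymbol U\cup\boldsymbol X\cup\{Y\},E)$ is a finite DAG with $\{0,1\}$-valued variables; $\boldsymbol U=\{U_0,U_1,\dots\}$ are hidden, $\boldsymbol X\cup\{Y\}$ observed; $Y$ has no outgoing edges; $U_0\equiv1$ has only outgoing edges (modelling self-activation). For every node $X\neq U_0$ with parents $\mathrm{Pa}(X)$: $P(X=1\mid \mathrm{Pa}(X)=\mathrm{pa}(X))=\boldsymbol\theta^*_X\cdot \mathrm{pa}(X)+\varepsilon_X\in[0,1]$, with $\boldsymbol\theta^*_X\in[0,1]^{|\mathrm{Pa}(X)|}$ and zero-mean sub-Gaussian noises $\varepsilon_X$, mutually independent over nodes. Probabilities $\Pr$ are taken over noise and variables. $\theta^*_{Z,X}$ is the weight of edge $(Z,X)$. Arbitrary edges involving hidden nodes are allowed, except that the following is excluded: a hidden node $U_s$ with $s>0$ has a directed path to an observed $X_i$ and a directed path to an observed descendant $X_j$ of $X_i$, with all nodes of both paths hidden except the end points $X_i$, $X_j$. $do(\boldsymbol S=\boldsymbol s)$ forces the variables in $\boldsymbol S$ to the values $\boldsymbol s$. **Transformed model $G'$.** $G'=(\{X_1\}\cup\boldsymbol X\cup\{Y\},E')$, with $X_1\notin\boldsymbol X\cup\{Y\}$ a new node constantly equal to $1$. A hidden path from observed $X_i$ to observed $X_j$ in $G$ is a directed path all of whose intermediate nodes (if any) are hidden; $\theta^*_P$ is the product of the weights on path $P$. If the set $\mathcal P^u_{X_i,X_j}$ of hidden paths is nonempty, $E'$ contains $(X_i,X_j)$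 with weight $\theta^{*\prime}_{X_i,X_j}=\sum_{P\in\mathcal P^u_{X_i,X_j}}\theta^*_P$. For each $X_i\in\boldsymbol X\cup\{Y\}$, $E'$ contains $(X_1,X_i)$ with weight $\theta^{*\prime}_{X_1,X_i}=\Pr\{X_i=1\mid do(\boldsymbol X\cup\{Y\}\setminus\{X_i\}=\boldsymbol0)\}$ (in $G$). The noise variables are carried over without change, and in $G'$, $P'(X=1\mid \mathrm{Pa}'(X)=\mathrm{pa}'(X))=\boldsymbol\theta^{*\prime}_X\cdot \mathrm{pa}'(X)+\varepsilon_X$, where $\mathrm{Pa}'(X)$ is the parent set in $G'$. *)

(* Defs.v *)
From HB Require Import structures.
From mathcomp Require Import all_boot all_order all_algebra.
From mathcomp Require Import all_classical all_reals all_analysis.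

Set Implicit Arguments.
Unset Strict Implicit.
Unset Printing Implicit Defensive.

Import Order.TTheory GRing.Theory Num.Theory.

Local Open Scope ring_scope.

Section Noise.
Context d (Omega : measurableType d) (R : realType) (P : probability Omega R).

(* Independence of the subfamily of X indexed by D: the product rule holds for
   every finite set of indices in D. *)
Definition mutually_independent (I : finType) (D : pred I)
    (X : I -> {RV P >-> R}) : Prop :=
  forall (J : {set I}) (B : I -> set R),
    {subset J <= D} -> (forall i, measurable (B i)) ->
    P [set w | forall i, i \in J -> B i (X i w)]%classic =
    (\prod_(i in J) P (X i @^-1` B i)%classic)%E.

Definition sub_gaussian (X : {RV P >-> R}) : Prop :=
  exists2 sigma : R, 0 <= sigma &
    forall t : R, ('M_P X t <= (expR (sigma ^+ 2 * t ^+ 2 / 2))%:E)%E.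

End Noise.

Section Network.
Context d (Omega : measurableType d) (R : realType) (P : probability Omega R).

(* [root] is the node that is constantly 1; its noise is never used, and
   [weight u v] is only meaningful when [edge u v]. *)
Record network (V : finType) := Network {
  edge : rel V;
  weight : V -> V -> R;
  root : V;
  noise : V -> {RV P >-> R}
}.

Variables (V : finType) (N : network V).

Definition parents (v : V) : {set V} := [set u | edge N u v].

Definition acyclic : Prop := forall u v, edge N u v -> ~~ connect (edge N) v u.

Definition descendant (u v : V) : bool :=
  [exists z, edge N u z && connect (edge N) z v].

Definition prob_one (w : Omega) (a : {ffun V -> bool}) (v : V) : R :=
  \sum_(u in parents v) weight N u v * (a u)%:R + noise N v w.

(* An intervention is a partial assignment: [iv v = Some b] means do(v = b). *)
Definition factor (iv : V -> option bool) (w : Omega) (a : {ffun V -> bool})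
    (v : V) : R :=
  if v == root N then (a v)%:R
  else if iv v is Some b then (a v == b)%:R
  else if a v then prob_one w a v else 1 - prob_one w a v.

(* Given the noise, the variables have the joint law obtained by multiplying
   the conditional probabilities of the nodes, those of the intervened nodes
   being replaced by point masses; the noise is then averaged out. *)
Definition prob (iv : V -> option bool) (A : {set {ffun V -> bool}}) : R :=
  fine ('E_P[(fun w => \sum_(a in A) \prod_v factor iv w a v)%R])%E.

Definition cond_prob (iv : V -> option bool) (A B : {set {ffun V -> bool}}) : R :=
  prob iv (A :&: B) / prob iv B.

End Network.

(* The nodes of G are H + O: [inl u] is hidden and [inr x] is observed.  The
   distinguished u0 : H is the constant node U_0 and y : O is the node Y. *)
Section HiddenVariables.
Context d (Omega : measurableType d) (R : realType) (P : probability Omega R).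
Variables (H O : finType).

Definition hidden (v : H + O) : bool := if v is inl _ then true else false.

Definition is_hidden_path (G : network P (H + O)%type) (u v : H + O)
    (q : seq (H + O)) : bool :=
  path (edge G) u (rcons q v) && all hidden q.

Definition admissible (G : network P (H + O)%type) (u0 : H) : Prop :=
  forall (u : H) (i j : O) (p q : seq (H + O)),
    u != u0 -> descendant G (inr i) (inr j) ->
    is_hidden_path G (inl u) (inr i) p ->
    is_hidden_path G (inl u) (inr j) q -> False.

(* The conditional probabilities are required to lie in [0,1] only for parent
   values that give U_0 its constant value 1. *)
Record hidden_BLM (G : network P (H + O)%type) (u0 : H) (y : O) : Prop := {
  hblm_root : root G = inl u0;
  hblm_acyclic : acyclic G;
  hblm_root_source : forall v, ~~ edge G v (inl u0);
  hblm_Y_sink : forall v, ~~ edge G (inr y) v;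
  hblm_weight : forall u v, edge G u v -> 0 <= weight G u v <= 1;
  hblm_range : forall v (a : {ffun H + O -> bool}),
    v != inl u0 -> a (inl u0) = true ->
    {ae P, forall w, 0 <= prob_one G w a v <= 1};
  hblm_indep : mutually_independent (fun v => v != inl u0) (noise G);
  hblm_mean : forall v, v != inl u0 -> ('E_P[noise G v] = 0)%E;
  hblm_subgauss : forall v, v != inl u0 -> sub_gaussian (noise G v);
  hblm_admissible : admissible G u0
}.

Definition do_obs (S : {set O}) (s : {ffun O -> bool}) (v : H + O) : option bool :=
  if v is inr x then (if x \in S then Some (s x) else None) else None.

Fixpoint path_weight (G : network P (H + O)%type) (u : H + O)
    (p : seq (H + O)) : R :=
  if p is v :: p' then weight G u v * path_weight G v p' else 1.

(* A hidden path is represented by its intermediate nodes; these are pairwise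
   distinct when G is acyclic, so bounding their number by #|H + O| loses no
   path. *)
Definition hidden_paths (G : network P (H + O)%type) (i j : O) :
    {set #|{: H + O}|.-bseq (H + O)} :=
  [set q : #|{: H + O}|.-bseq (H + O) | is_hidden_path G (inr i) (inr j) q].

(* The node [None] of G' is the new constant node X_1. *)
Definition edge' (G : network P (H + O)%type) : rel (option O) :=
  fun u v => match u, v with
  | _, None => false
  | None, Some _ => true
  | Some i, Some j => hidden_paths G i j != finset.set0
  end.

Definition weight' (G : network P (H + O)%type) (u v : option O) : R :=
  match u, v with
  | _, None => 0
  | None, Some i =>
      prob G (do_obs (~: [set i]) [ffun=> false])
        [set a : {ffun H + O -> bool} | a (inr i)]
  | Some i, Some j =>
      \sum_(q in hidden_paths G i j) path_weight G (inr i) (rcons q (inr j))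
  end.

Definition noise' (G : network P (H + O)%type) (v : option O) : {RV P >-> R} :=
  if v is Some i then noise G (inr i) else cst 0.

Definition transform (G : network P (H + O)%type) : network P (option O) :=
  Network (edge' G) (weight' G) None (noise' G).

Definition do_obs' (S : {set O}) (s : {ffun O -> bool}) (v : option O) :
    option bool :=
  if v is Some x then (if x \in S then Some (s x) else None) else None.

End HiddenVariables.

(* Main.v *)
(* Averaging over the independent centred noise replaces every conditional law
   by its noise-free linear version.  In the resulting finite model, let [F] be
   the indicator of the conditioning event.  If [F] ignores a node [v] and its
   descendants, then [E (v F)] is the weighted sum of [E (u F)] over the parents
   [u] of [v].  Admissibility makes this applicable to [x] and to every hidden
   ancestor of [x] along a hidden path, so the linear equations can be solved
   back to the observed parents of [x] in [G'] and the root: the coefficients are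
   sums of path weights, and the one of the root is identified with the weight of
   the edge from [X_1] by solving the same equations under [do(0)]. *)
From Pilot Require Import Defs.
From mathcomp Require Import all_boot all_order all_algebra.
From mathcomp Require Import all_classical all_reals all_analysis.
From mathcomp Require Import measurable_realfun.
From mathcomp Require Import ring lra.

Set Implicit Arguments.
Unset Strict Implicit.
Unset Printing Implicit Defensive.

Import Pilot.Defs Order.TTheory GRing.Theory Num.Theory.

Local Open Scope ring_scope.

(** * Products of independent random variables *)

(** The bound holds at every point, which makes the class stable under products and composition.
    Noises are bounded only almost surely and enter it after truncation. *)
Definition bounded_measurable d (T : measurableType d) (R : realType)
    (f : T -> R) : Prop :=
  measurable_fun setT f /\ exists M, forall w, `|f w| <= M.

Section BoundedMeasurable.
Context d (T : measurableType d) (R : realType).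
Implicit Types f g : T -> R.

Lemma bounded_measurable_cst (c : R) : bounded_measurable (fun _ : T => c).
Proof. by split; [exact: measurable_cst | exists `|c|]. Qed.

Lemma bounded_measurableD f g : bounded_measurable f -> bounded_measurable g ->
  bounded_measurable (fun w => f w + g w).
Proof.
move=> [mf [M fM]] [mg [N gN]]; split; first exact: measurable_funD.
by exists (M + N) => w; rewrite (le_trans (ler_normD _ _)) ?lerD.
Qed.

Lemma bounded_measurableM f g : bounded_measurable f -> bounded_measurable g ->
  bounded_measurable (fun w => f w * g w).
Proof.
move=> [mf [M fM]] [mg [N gN]]; split; first exact: measurable_funM.
by exists (M * N) => w; rewrite normrM ler_pM.
Qed.

Lemma bounded_measurable_prod (I : finType) (J : pred I) (F : I -> T -> R) :
  (forall i, J i -> bounded_measurable (F i)) ->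
  bounded_measurable (fun w => \prod_(i | J i) F i w).
Proof.
move=> bF; rewrite (_ : (fun w => _) =
    \big[(fun f g w => f w * g w)/fun=> 1]_(i | J i) F i); last first.
  by apply/funext => w; elim/big_rec2 : _ => // i u _ _ ->.
elim/big_ind : _ => //; first exact: bounded_measurable_cst.
exact: bounded_measurableM.
Qed.

Lemma bounded_measurable_indic (A : set T) : measurable A ->
  bounded_measurable (\1_A : T -> R).
Proof.
move=> mA; split; first exact: measurable_indic.
by exists 1 => w; rewrite indicE; case: (_ \in _); rewrite ?normr1 ?normr0.
Qed.

Lemma bounded_measurable_comp d' (U : measurableType d') (h : U -> R)
    (X : T -> U) :
  bounded_measurable h -> measurable_fun setT X ->
  bounded_measurable (fun w => h (X w)).
Proof.
move=> [mh [M hM]] mX; split; last by exists M => w; exact: hM.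
exact: measurableT_comp.
Qed.

End BoundedMeasurable.

Section Expectation.
Context d (T : measurableType d) (R : realType) (P : probability T R).

Definition mean (f : T -> R) : R := fine ('E_P[f])%E.

Lemma mean_Rintegral f : mean f = (\int[P]_w f w)%R.
Proof. by rewrite /mean unlock. Qed.

Lemma bounded_measurable_integrable (f : T -> R) : bounded_measurable f ->
  P.-integrable setT (EFin \o f).
Proof.
move=> [mf [M fM]]; apply: measurable_bounded_integrable => //.
  by rewrite (le_lt_trans (probability_le1 _ _)) ?ltry.
exists M; split; [exact: num_real|]; move=> x Mx w _ /=.
by rewrite (le_trans (fM w)) ?ltW.
Qed.

Lemma meanD (f g : T -> R) : bounded_measurable f -> bounded_measurable g ->
  mean (fun w => f w + g w) = mean f + mean g.
Proof.
by move=> bf bg; rewrite !mean_Rintegral RintegralD//;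
  exact: bounded_measurable_integrable.
Qed.

Lemma meanZ (c : R) (f : T -> R) : bounded_measurable f ->
  mean (fun w => c * f w) = c * mean f.
Proof.
by move=> bf; rewrite !mean_Rintegral RintegralZl//;
  exact: bounded_measurable_integrable.
Qed.

Lemma mean_cst (c : R) : mean (fun=> c) = c.
Proof. by rewrite /mean expectation_cst. Qed.

Lemma mean_sum (I : Type) (r : seq I) (A : pred I) (F : I -> T -> R) :
  (forall i, bounded_measurable (F i)) ->
  mean (fun w => \sum_(i <- r | A i) F i w) = \sum_(i <- r | A i) mean (F i).
Proof.
move=> bF.
suff [] : bounded_measurable (fun w => \sum_(i <- r | A i) F i w) /\
  mean (fun w => \sum_(i <- r | A i) F i w) = \sum_(i <- r | A i) mean (F i) by [].
elim: r => [|i r [bS IH]].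
  under eq_fun do rewrite big_nil.
  by rewrite big_nil mean_cst; split => //; exact: bounded_measurable_cst.
under eq_fun do rewrite big_cons; rewrite big_cons.
case: (A i) => //; rewrite meanD// IH; split => //.
exact: bounded_measurableD.
Qed.

Lemma mean_indic (A : set T) : measurable A -> mean (\1_A) = fine (P A).
Proof. by move=> mA; rewrite /mean expectation_indic. Qed.

Lemma mean_norm_le (f : T -> R) (M : R) : bounded_measurable f ->
  (forall w, `|f w| <= M) -> `|mean f| <= M.
Proof.
move=> bf fM; rewrite mean_Rintegral.
apply: le_trans (le_normr_Rintegral _ _) _ => //.
  exact: bounded_measurable_integrable.
rewrite -[leRHS](mean_cst M) mean_Rintegral; apply: le_Rintegral => //.
- apply: bounded_measurable_integrable.
  case: bf => mf _; split; first exact: measurableT_comp.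
  by exists M => w; rewrite normr_id.
- exact: bounded_measurable_integrable (bounded_measurable_cst _ _).
Qed.

Lemma mean_ae (f g : T -> R) : measurable_fun setT f -> measurable_fun setT g ->
  {ae P, forall w, f w = g w} -> mean f = mean g.
Proof.
move=> mf mg fg; rewrite /mean unlock; congr fine.
apply: ae_eq_integral => //; [exact/measurable_EFinP|exact/measurable_EFinP|].
by apply: filterS fg => w fgw _ /=; rewrite fgw.
Qed.

(* The error bound halves at each stage: half of the current bound, with the sign
   of the current error, is added to [phi]. *)
Lemma uncorrelated_approx (X : T -> R) (Z : T -> R) (h : R -> R) (a : R) (n : nat) :
  measurable_fun setT X -> bounded_measurable Z ->
  (forall B, measurable B ->
    mean (fun w => \1_B (X w) * Z w) = mean (fun w => \1_B (X w)) * mean Z) ->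
  measurable_fun setT h -> (forall t, `|h t| <= a) ->
  exists2 phi : R -> R, bounded_measurable phi /\
    mean (fun w => phi (X w) * Z w) = mean (fun w => phi (X w)) * mean Z &
    forall t, `|h t - phi t| <= a / 2 ^+ n.
Proof.
move=> mX bZ HB mh ha; elim: n => [|n [phi [bphi Hphi] happ]].
  exists (fun=> 0); last by move=> t; rewrite subr0 expr0 divr1.
  split; first exact: bounded_measurable_cst.
  rewrite mean_cst mul0r (_ : (fun w => _) = fun=> 0) ?mean_cst//.
  by apply/funext => w; rewrite mul0r.
pose b := a / 2 ^+ n.+1.
pose B := [set t | 0 <= h t - phi t]%classic.
have mB : measurable B.
  rewrite [B](_ : _ = setT `&` [set t | (0 : R) <= h t - phi t])%classic; last first.
    by rewrite setTI.
  by apply: measurable_fun_le => //; apply: measurable_funB => //; case: bphi.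
have b1 : bounded_measurable (\1_B : R -> R) by exact: bounded_measurable_indic.
have bX (g : R -> R) : bounded_measurable g -> bounded_measurable (fun w => g (X w)).
  by move=> bg; exact: bounded_measurable_comp.
have bc c : bounded_measurable (fun _ : T => c : R) by exact: bounded_measurable_cst.
(* The correction is [b] on [B] and [- b] off [B]. It is affine in [\1_B], so the product rule
   survives by linearity. *)
exists (fun t => phi t + (2 * b * \1_B t + - b)).
  split.
    apply: bounded_measurableD => //.
    apply: bounded_measurableD; last exact: bounded_measurable_cst.
    by apply: bounded_measurableM => //; exact: bounded_measurable_cst.
  rewrite (_ : (fun w => _) = (fun w => phi (X w) * Z w +
     (2 * b * (\1_B (X w) * Z w) + - b * Z w))); last by apply/funext => w; ring.
  have bXZ (g : R -> R) : bounded_measurable g ->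
      bounded_measurable (fun w => g (X w) * Z w).
    by move=> bg; apply: bounded_measurableM => //; exact: bX.
  have bZZ (g : T -> R) c : bounded_measurable g ->
      bounded_measurable (fun w : T => c * g w : R).
    by move=> bg; apply: bounded_measurableM.
  have bphiX := bX _ bphi; have b1X := bX _ b1.
  have bphiXZ := bXZ _ bphi; have b1XZ := bXZ _ b1.
  have bDD := @bounded_measurableD _ T R.
  rewrite !meanD ?meanZ ?Hphi ?HB ?mean_cst; try by auto.
  by ring.
move=> t; have := happ t.
have -> : a / 2 ^+ n = 2 * b by rewrite /b exprS invfM; field; rewrite expf_neq0.
rewrite indicE; have [|] := boolP (t \in B).
  rewrite inE /B /= => r0; rewrite ger0_norm// ler_norml -/b => rb.
  by rewrite mulr1; apply/andP; split; lra.
move=> /negP tB; have : h t - phi t < 0.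
  by rewrite ltNge; apply/negP => ?; apply: tB; rewrite inE.
move=> r0; rewrite ltr0_norm// ler_norml -/b => rb.
by rewrite mulr0; apply/andP; split; lra.
Qed.

(** [h] is a uniform limit of functions satisfying the product rule, and [Z] is bounded, so both
    sides differ by less than any positive [e]. *)
Lemma uncorrelated_comp (X : T -> R) (Z : T -> R) (h : R -> R) :
  measurable_fun setT X -> bounded_measurable Z ->
  (forall B, measurable B ->
    mean (fun w => \1_B (X w) * Z w) = mean (fun w => \1_B (X w)) * mean Z) ->
  bounded_measurable h ->
  mean (fun w => h (X w) * Z w) = mean (fun w => h (X w)) * mean Z.
Proof.
move=> mX bZ HB bh; case: (bh) => mh [a ha]; case: (bZ) => mZ [c Zc].
have a0 : 0 <= a by exact: le_trans (ha 0).
(* The sign of [c] is read off at a point of [T]; over an empty [T] all integrals are zero. *)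
have [[w0 _]|T0] := pselect (exists w : T, True); last first.
  have TE : (setT = set0 :> set T)%classic.
    by apply/seteqP; split => // w _; exfalso; apply: T0; exists w.
  by rewrite !mean_Rintegral /Rintegral TE !integral_set0 mulr0.
have c0 : 0 <= c by exact: le_trans (Zc w0).
apply/eqP; rewrite -subr_eq0 -normr_le0; apply/ler_addgt0Pl => e e0; rewrite addr0.
(* The remainder [r] enters twice below, each time with a contribution of at most
   [a / 2 ^+ n * c]. *)
have [n hn] : exists n : nat, 2 * a * c / e < 2 ^+ n.
  exists (Num.truncn (2 * a * c / e)).+1.
  apply: lt_trans (truncnS_gt _) _ => //.
  by rewrite -natrX ltr_nat ltn_expl.
have [phi [bphi Hphi] happ] := uncorrelated_approx n mX bZ HB mh ha.
pose r t := h t - phi t.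
have br : bounded_measurable r.
  split; first by apply: measurable_funB => //; case: bphi.
  by exists (a / 2 ^+ n).
have bX (g : R -> R) : bounded_measurable g -> bounded_measurable (fun w => g (X w)).
  by move=> bg; exact: bounded_measurable_comp.
have bXZ (g : R -> R) : bounded_measurable g ->
      bounded_measurable (fun w => g (X w) * Z w).
  by move=> bg; apply: bounded_measurableM => //; exact: bX.
have -> : mean (fun w => h (X w) * Z w) =
   mean (fun w => phi (X w) * Z w) + mean (fun w => r (X w) * Z w).
  rewrite -meanD; [|by auto..]; congr mean; apply/funext => w; rewrite /r; ring.
have -> : mean (fun w => h (X w)) =
   mean (fun w => phi (X w)) + mean (fun w => r (X w)).
  rewrite -meanD; [|by auto..]; congr mean; apply/funext => w; rewrite /r; ring.
rewrite Hphi (_ : _ - _ =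
    mean (fun w => r (X w) * Z w) - mean (fun w => r (X w)) * mean Z); last by ring.
have H1 : `|mean (fun w => r (X w) * Z w)| <= a / 2 ^+ n * c.
  by apply: mean_norm_le; [auto | move=> w; rewrite normrM ler_pM ?happ].
have H2 : `|mean (fun w => r (X w)) * mean Z| <= a / 2 ^+ n * c.
  rewrite normrM ler_pM//; apply: mean_norm_le => //.
    exact: bX.
  by move=> w; exact: happ.
apply: le_trans (ler_normB _ _) _; apply: le_trans (lerD H1 H2) _.
rewrite ltr_pdivrMr// in hn.
have p0 : 0 < 2 ^+ n :> R by rewrite exprn_gt0.
rewrite (_ : _ + _ = (2 * a * c) / 2 ^+ n); last by ring.
by rewrite ler_pdivrMr// [e * _]mulrC ltW.
Qed.

End Expectation.

Section Independence.
Context d (T : measurableType d) (R : realType) (P : probability T R).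
Variables (I : finType) (D : pred I) (X : I -> {RV P >-> R}).
Hypothesis indepX : mutually_independent D X.

Lemma mean_prod_indep (J : {set I}) (h : I -> R -> R) :
  {subset J <= D} -> (forall i, bounded_measurable (h i)) ->
  mean P (fun w => \prod_(i in J) h i (X i w)) =
  \prod_(i in J) mean P (fun w => h i (X i w)).
Proof.
move=> JD.
have mX i : measurable_fun setT (X i) by exact: measurable_funPT.
suff main (K : seq I) : forall h : I -> R -> R,
    (forall i, bounded_measurable (h i)) ->
    (forall i, i \in J -> i \notin K ->
       exists2 B : set R, measurable B & h i = \1_B) ->
    mean P (fun w => \prod_(i in J) h i (X i w)) =
    \prod_(i in J) mean P (fun w => h i (X i w)).
  move=> bh; apply: (main (enum I)) => // i _.
  by rewrite mem_enum.
elim: K => [|v K IH] {}h bh hK.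
  (* [mutually_independent] wants a measurable set at every index, hence [setT] outside [J]. *)
  have /choice[B HB] i : exists B : set R, measurable B /\ (i \in J -> h i = \1_B).
    have [iJ|] := boolP (i \in J); last by exists setT.
    by have [//|B mB hB] := hK i iJ; exists B.
  have hE i w : i \in J -> h i (X i w) = (\1_(X i @^-1` B i)%classic w : R).
    by case: (HB i) => _ + iJ => /(_ iJ) ->; rewrite !indicE.
  pose E := [set w | forall i, i \in J -> B i (X i w)]%classic.
  have mXB i : measurable (X i @^-1` B i)%classic.
    by rewrite -[X in measurable X]setTI; apply: mX => //; case: (HB i).
  have mE : measurable E.
    rewrite [E](_ : _ = \bigcap_(i in [set` J]) (X i @^-1` B i))%classic.
      by apply: fin_bigcap_measurable => // i _.
    by apply/seteqP; split=> w /= Hw i /=; exact: Hw.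
  rewrite (_ : (fun w => _) = \1_E); last first.
    apply/funext => w; rewrite indicE; have [|] := boolP (w \in E).
      rewrite inE => wE; rewrite big1// => i iJ.
      by rewrite hE// indicE mem_set//; exact: wE.
    rewrite notin_setE => /existsNP[i /not_implyP[iJ nB]].
    by rewrite (bigD1 i)//= hE// indicE memNset// mul0r.
  rewrite mean_indic// indepX//; last by move=> i; case: (HB i).
  rewrite (eq_bigr (fun i => (fine (P (X i @^-1` B i)%classic))%:E)).
    rewrite prodEFin/=; apply: eq_bigr => i iJ.
    by under [in RHS]eq_fun do rewrite hE//; rewrite mean_indic.
  by move=> i _; rewrite fineK// fin_num_measure.
have [vJ|vJ] := boolP (v \in J); last first.
  apply: IH => // i iJ iK; apply: hK => //.
  by rewrite inE negb_or iK andbT; apply: contraNneq vJ => <-.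
pose Z w := \prod_(i in J | i != v) h i (X i w).
pose m := \prod_(i in J | i != v) mean P (fun w => h i (X i w)).
have bZ : bounded_measurable Z.
  by apply: bounded_measurable_prod => i _; exact: bounded_measurable_comp.
(* With [h v] replaced by an indicator, the induction hypothesis applies; [uncorrelated_comp] then
   restores [h v]. *)
have HB B : measurable B ->
    mean P (fun w => \1_B (X v w) * Z w) = mean P (fun w => \1_B (X v w)) * m.
  move=> mB; pose h' i := if i == v then \1_B else h i.
  have h'v : h' v = \1_B by rewrite /h' eqxx.
  have h'D i : i != v -> h' i = h i by rewrite /h' => /negbTE ->.
  have E1 w : \prod_(i in J) h' i (X i w) = \1_B (X v w) * Z w.
    by rewrite (bigD1 v)//= h'v; congr (_ * _); apply: eq_bigr => i /andP[_ /h'D->].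
  have E2 : \prod_(i in J) mean P (fun w => h' i (X i w)) =
      mean P (fun w => \1_B (X v w)) * m.
    by rewrite (bigD1 v)//= h'v; congr (_ * _); apply: eq_bigr => i /andP[_ /h'D->].
  under eq_fun do rewrite -E1.
  rewrite -E2; apply: IH.
    by move=> i; rewrite /h'; case: eqP => // _; exact: bounded_measurable_indic.
  move=> i iJ iK; rewrite /h'; case: eqVneq => [_|iv]; first by exists B.
  by apply: hK => //; rewrite inE negb_or iv.
(* The case where [B] is the whole line. *)
have mZ : mean P Z = m.
  have := HB _ measurableT; rewrite indicT mean_cst mul1r => <-.
  by congr mean; apply/funext => w; rewrite mul1r.
rewrite (bigD1 v)//= -/m -mZ.
rewrite (_ : (fun w => _) = (fun w => h v (X v w) * Z w)); last first.
  by apply/funext => w; rewrite (bigD1 v).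
by apply: uncorrelated_comp => // B mB; rewrite HB// mZ.
Qed.

End Independence.

(** * Averaging out the noise *)

Section ExactLaw.
Context d (Omega : measurableType d) (R : realType) (P : probability Omega R).
Variables (V : finType) (N : network P V).

(** The constant term of [factor] as an affine function of the noise; [noise_sign] is its slope. *)
Definition mean_factor (iv : V -> option bool) (a : {ffun V -> bool}) (v : V) : R :=
  if v == root N then (a v)%:R
  else if iv v is Some b then (a v == b)%:R
  else let p := \sum_(u in parents N v) weight N u v * (a u)%:R in
    if a v then p else 1 - p.

Definition noise_sign (iv : V -> option bool) (a : {ffun V -> bool}) (v : V) : R :=
  if v == root N then 0 else if iv v is Some b then 0
  else if a v then 1 else -1.

Lemma factorE iv w a v :
  factor N iv w a v = mean_factor iv a v + noise_sign iv a v * noise N v w.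
Proof.
rewrite /factor /mean_factor /noise_sign /prob_one.
case: ifP => _; first by rewrite mul0r addr0.
case: (iv v) => [b|]; first by rewrite mul0r addr0.
by case: (a v); ring.
Qed.

Definition truncate (M t : R) : R := Num.max (- M) (Num.min M t).

Lemma bounded_measurable_truncate M : bounded_measurable (truncate M).
Proof.
split.
  apply: measurable_maxr; first exact: measurable_cst.
  by apply: measurable_minr; [exact: measurable_cst|exact: measurable_id].
exists `|M| => t; have := ler_norm M; have := ler_norm (- M); rewrite normrN => NM MM.
by rewrite ler_norml /truncate le_max lerN2 MM ge_max NM ge_min MM.
Qed.

Lemma truncate_id M t : `|t| <= M -> truncate M t = t.
Proof.
by rewrite ler_norml => /andP[Mt tM]; rewrite /truncate (min_idPr tM) (max_idPr Mt).
Qed.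

Hypothesis indepN : mutually_independent (fun v => v != root N) (noise N).
Hypothesis mean0N : forall v, v != root N -> ('E_P[noise N v] = 0)%E.
Hypothesis boundedN : forall v, v != root N ->
  exists M : R, {ae P, forall w, `|noise N v w| <= M}.

(** Each factor is affine in the noise of its own node. By independence the mean of the product is
    the product of the means, and a centred noise leaves only the constant term. *)
Lemma probE iv A : prob N iv A = \sum_(a in A) \prod_v mean_factor iv a v.
Proof.
have /choice[M HM] v : exists M : R, v != root N ->
    {ae P, forall w, `|noise N v w| <= M}.
  by case: (boolP (v != root N)) => [/boundedN[M HM]|]; [exists M|exists 0].
pose h a v t := mean_factor iv a v + noise_sign iv a v * truncate (M v) t.
have bh a v : bounded_measurable (h a v).
  apply: bounded_measurableD; first exact: bounded_measurable_cst.
  apply: bounded_measurableM; first exact: bounded_measurable_cst.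
  exact: bounded_measurable_truncate.
have mN v : measurable_fun setT (noise N v) by exact: measurable_funPT.
have bhN a v : bounded_measurable (fun w => h a v (noise N v w)).
  exact: bounded_measurable_comp.
have btrunc v : bounded_measurable (fun w => truncate (M v) (noise N v w)).
  apply: (bounded_measurable_comp (h := truncate (M v))) => //.
  exact: bounded_measurable_truncate.
have mean_trunc v : v != root N -> mean P (fun w => truncate (M v) (noise N v w)) = 0.
  move=> vr; rewrite -[RHS]/(fine 0%E) -(mean0N vr); apply: mean_ae => //.
    by apply: measurableT_comp => //; case: (bounded_measurable_truncate (M v)).
  by apply: filterS (HM v vr) => w /truncate_id.
have mean_h a v : mean P (fun w => h a v (noise N v w)) = mean_factor iv a v.
  rewrite meanD ?meanZ ?mean_cst//; first last.
  - by apply: bounded_measurableM => //; exact: bounded_measurable_cst.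
  - exact: bounded_measurable_cst.
  have [vr|vr] := eqVneq v (root N); last by rewrite mean_trunc// mulr0 addr0.
  by rewrite /noise_sign vr eqxx mul0r addr0.
rewrite /prob -/(mean P _).
(* Truncating the finitely many noises changes the integrand only on a null set. *)
rewrite (_ : mean P _ =
    mean P (fun w => \sum_(a in A) \prod_v h a v (noise N v w))); last first.
  apply: mean_ae.
  - under eq_fun do rewrite -big_enum.
    apply: measurable_sum => a; apply: measurable_prod => v _.
    under eq_fun do rewrite factorE.
    apply: measurable_funD; first exact: measurable_cst.
    by apply: measurable_funM => //; exact: measurable_cst.
  - under eq_fun do rewrite -big_enum.
    apply: measurable_sum => a; apply: measurable_prod => v _.
    by case: (bhN a v).
  have : {ae P, forall w, forall v, v != root N -> `|noise N v w| <= M v}.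
    apply: filter_forall => v; have [->|vr] := eqVneq v (root N); first exact: aeW.
    by apply: filterS (HM v vr).
  apply: filterS => w Hw; apply: eq_bigr => a _; apply: eq_bigr => v _.
  rewrite factorE /h; have [->|/Hw/truncate_id->//] := eqVneq v (root N).
  by rewrite /noise_sign eqxx !mul0r.
rewrite mean_sum => [|a]; last exact: bounded_measurable_prod.
(* The root lies outside the independent family; its slope is zero, so its factor is a constant that
   leaves the mean. *)
apply: eq_bigr => a _; rewrite (bigD1 (root N))//=.
pose J := [set v | v != root N].
have bZ : bounded_measurable (fun w => \prod_(v in J) h a v (noise N v w)).
  exact: bounded_measurable_prod.
rewrite (_ : (fun w => _) = fun w => mean_factor iv a (root N) *
    \prod_(v in J) h a v (noise N v w)); last first.
  apply/funext => w; rewrite (bigD1 (root N))//= {1}/h /noise_sign eqxx mul0r addr0.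
  by congr (_ * _); apply: eq_bigl => v; rewrite inE.
rewrite meanZ// (mean_prod_indep indepN)//; last by move=> v; rewrite inE.
congr (_ * _); rewrite (eq_bigl (fun v => v != root N)) => [|v]; last by rewrite inE.
exact: eq_bigr.
Qed.

End ExactLaw.

(** * Finite linear networks *)

Section FlipSum.
Context (R : realFieldType) (V : finType).
Implicit Types (a b : {ffun V -> bool}) (g : {ffun V -> bool} -> R).

Definition flip (v : V) a : {ffun V -> bool} :=
  [ffun u => if u == v then ~~ a u else a u].

Lemma flip_same v a : flip v a v = ~~ a v.
Proof. by rewrite ffunE eqxx. Qed.

Lemma flip_other v a u : u != v -> flip v a u = a u.
Proof. by move=> /negbTE uv; rewrite ffunE uv. Qed.

Lemma flipK v : involutive (flip v).
Proof.
by move=> a; apply/ffunP => u; rewrite !ffunE; case: eqP => // _; rewrite negbK.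
Qed.

(** [flip v] is an involution, so summing over the pairs formed by [a] and [flip v a] counts every
    term twice. *)
Lemma eq_sum_flip v g h :
  (forall a, g a + g (flip v a) = h a + h (flip v a)) ->
  \sum_a g a = \sum_a h a.
Proof.
move=> gh.
have dbl k : \sum_a k a + \sum_a k a = \sum_a (k a + k (flip v a)) :> R.
  rewrite big_split/=; congr (_ + _).
  by rewrite (reindex_inj (inv_inj (flipK v))).
have : \sum_a g a + \sum_a g a = \sum_a h a + \sum_a h a.
  by rewrite !dbl; apply: eq_bigr => a _.
lra.
Qed.

Definition ignores (D : {set V}) g : Prop :=
  forall a b, (forall u, u \notin D -> a u = b u) -> g a = g b.

Lemma ignores_flip D g v a : ignores D g -> v \in D -> g (flip v a) = g a.
Proof.
move=> gD vD; apply: gD => u uD; rewrite flip_other//.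
by apply: contraNneq uD => ->.
Qed.

Lemma ignoresS (D D' : {set V}) g : D' \subset D -> ignores D g -> ignores D' g.
Proof.
move=> sD gD a b ab; apply: gD => u uD; apply: ab.
by apply: contra uD; exact: (fintype.subsetP sD).
Qed.

Lemma ignoresM D g h : ignores D g -> ignores D h ->
  ignores D (fun a => g a * h a).
Proof. by move=> gD hD a b ab; rewrite (gD _ _ ab) (hD _ _ ab). Qed.

End FlipSum.

Section DAGSum.
Context (R : realFieldType) (V : finType) (e : rel V).
Hypothesis acyclic_e : forall u v, e u v -> ~~ connect e v u.
Variable f : {ffun V -> bool} -> V -> R.
Hypothesis f_local : forall (a b : {ffun V -> bool}) v,
  a v = b v -> (forall u, e u v -> a u = b u) -> f a v = f b v.
Hypothesis f_total : forall (a : {ffun V -> bool}) v, f a v + f (flip v a) v = 1.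

Lemma f_flip v a u : u != v -> ~~ e v u -> f (flip v a) u = f a u.
Proof.
move=> uv evu; apply: f_local => [|w ewu]; first exact: flip_other.
by apply: flip_other; apply: contraNneq evu => <-.
Qed.

(** Take [w] in [D] with the fewest ancestors: a predecessor in [D] would have strictly fewer, since
    by acyclicity [w] is not among them. *)
Lemma exists_source (D : {set V}) : D != finset.set0 ->
  exists2 w, w \in D & forall u, u \in D -> ~~ e u w.
Proof.
move=> /set0Pn[w0 w0D].
case: (arg_minnP (fun w => #|[set u | connect e u w]|) w0D) => w wD wmin.
exists w => // u uD; apply/negP => euw.
have := wmin u uD; rewrite leqNgt => /negP; apply; apply: proper_card.
apply/properP; split.
  by apply/fintype.subsetP => z; rewrite !inE => /connect_trans; apply; exact: connect1.
by exists w; rewrite !inE ?connect0//; exact: acyclic_e.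
Qed.

(* Replacing the conditional laws on [D] by fair coins avoids having to delete
   coordinates from the assignments. *)
Lemma sum_out (D : {set V}) (g : {ffun V -> bool} -> R) :
  (forall u v, u \in D -> e u v -> v \in D) -> ignores D g ->
  \sum_a g a * \prod_v f a v =
  \sum_a g a * \prod_v (if v \in D then 2^-1 else f a v).
Proof.
elim: {D}_.+1 {-2}D (ltnSn #|D|) => // n IH D Dn Dcl gD.
have [->|/exists_source[w wD wsrc]] := eqVneq D finset.set0.
  by apply: eq_bigr => a _; congr (_ * _); apply: eq_bigr => v _; rewrite inE.
(* Removing a source [w] keeps the set closed under edges, as no edge from [D] enters [w]. *)
rewrite (IH (D :\ w)%SET).
(* Flipping [w] leaves [g] and the other factors alone: nodes of [D] other than [w] carry coins, and
   nodes outside [D] do not have [w] as a parent. The factor of [w] sums to one over the pair in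
   both versions. *)
- apply: (@eq_sum_flip _ _ w) => a.
  rewrite (ignores_flip _ gD wD).
  pose r b := \prod_(v | v != w) (if v \in D then 2^-1 else f b v).
  have rE : r (flip w a) = r a.
    apply: eq_bigr => v vw; case: ifPn => // vD; apply: f_flip => //.
    by apply: contra vD; exact: Dcl.
  have E1 b : \prod_v (if v \in (D :\ w)%SET then 2^-1 else f b v) = f b w * r b.
    rewrite (bigD1 w)//= !inE eqxx/=; congr (_ * _).
    by apply: eq_bigr => v vw; rewrite !inE vw.
  have E2 b : \prod_v (if v \in D then 2^-1 else f b v) = 2^-1 * r b.
    by rewrite (bigD1 w)//= wD.
  rewrite !E1 !E2 rE.
  rewrite -mulrDr -mulrDl f_total mul1r.
  by rewrite -mulrDr -mulrDl; congr (_ * _); field.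
- by rewrite -ltnS (leq_trans _ Dn)// ltnS [#|D|](cardsD1 w) wD.
- move=> u v; rewrite !inE => /andP[uw uD] euv.
  rewrite (Dcl _ _ uD euv) andbT.
  by apply: contraTneq euv => ->; exact: wsrc.
- by apply: ignoresS gD; exact: finset.subsetDl.
Qed.

(** Taking [D] to be all nodes turns the law into independent fair coins. *)
Lemma sum_prod1 : \sum_a \prod_v f a v = 1.
Proof.
rewrite (eq_bigr (fun a => 1 * \prod_v f a v)) => [|a _]; last by rewrite mul1r.
rewrite (sum_out (D := [set: V]))//.
under eq_bigr => a _.
  rewrite mul1r; under eq_bigr do rewrite inE.
  rewrite prodr_const; over.
rewrite sumr_const card_ffun card_bool -[_ *+ (_ ^ _)]mulr_natr natrX -exprMn mulVf//.
by rewrite expr1n.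
Qed.

(** Once the strict descendants of [v] are summed out, only the law of [v] itself reacts to flipping
    [v], and each pair contributes [p a] times the same quantity on both sides. *)
Lemma sum_markov v (p g : {ffun V -> bool} -> R) :
  (forall a, f a v = if a v then p a else 1 - p a) ->
  ignores [set u | connect e v u] p -> ignores [set u | connect e v u] g ->
  \sum_(a : {ffun V -> bool}) (a v)%:R * g a * \prod_u f a u =
  \sum_a p a * g a * \prod_u f a u.
Proof.
(* [v] itself stays out of [D], because the factor [(a v)%:R] reads it. *)
move=> fv pv gv; pose D := [set u | (u != v) && connect e v u].
have Dv : D \subset [set u | connect e v u].
  by apply/fintype.subsetP => u; rewrite !inE => /andP[].
have pD := ignoresS Dv pv; have gD := ignoresS Dv gv.
have Dcl u w : u \in D -> e u w -> w \in D.
  rewrite !inE => /andP[_ vu] euw.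
  have -> : connect e v w by exact: connect_trans (connect1 euw).
  by rewrite andbT; apply: contraTneq euw => ->; apply: contraL vu; exact: acyclic_e.
have vD : ignores D (fun a => (a v)%:R : R).
  by move=> a b ab; rewrite ab// inE eqxx.
rewrite !(sum_out Dcl); [|exact: ignoresM..].
apply: (@eq_sum_flip _ _ v) => a.
have vv : v \in [set u | connect e v u] by rewrite inE connect0.
rewrite !(ignores_flip _ gv vv) !(ignores_flip _ pv vv).
pose r b := \prod_(u | u != v) (if u \in D then 2^-1 else f b u).
have rE : r (flip v a) = r a.
  apply: eq_bigr => u uv; case: ifPn => // uD; apply: f_flip => //.
  by apply: contra uD => evu; rewrite inE uv connect1.
have E1 b : \prod_u (if u \in D then 2^-1 else f b u) = f b v * r b.
  by rewrite (bigD1 v)//= {1}inE eqxx.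
rewrite !E1 rE !fv flip_same (ignores_flip _ pv vv).
by case: (a v) => /=; ring.
Qed.

End DAGSum.

(** * Linear equations for expectations *)

Section NetworkExpectation.
Context d (Omega : measurableType d) (R : realType) (P : probability Omega R).
Variables (V : finType) (N : network P V).
Hypothesis acyclicN : acyclic N.
Implicit Types (iv : V -> option bool) (a b : {ffun V -> bool})
  (F : {ffun V -> bool} -> R).

Definition expect iv F : R := \sum_a F a * \prod_v mean_factor N iv a v.

Lemma eq_expect iv F F' :
  (forall a, F a * \prod_v mean_factor N iv a v = F' a * \prod_v mean_factor N iv a v) ->
  expect iv F = expect iv F'.
Proof. by move=> FF'; apply: eq_bigr => a _. Qed.

Lemma expectZ iv c F : expect iv (fun a => c * F a) = c * expect iv F.
Proof. by rewrite mulr_sumr; apply: eq_bigr => a _; rewrite mulrA. Qed.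

Lemma mean_factor_local iv a b v :
  a v = b v -> (forall u, edge N u v -> a u = b u) ->
  mean_factor N iv a v = mean_factor N iv b v.
Proof.
move=> abv ab; rewrite /mean_factor abv.
by under eq_bigr => u do [rewrite inE => /ab ->].
Qed.

Lemma edge_irr v : ~~ edge N v v.
Proof. by apply/negP => /[dup] /acyclicN; rewrite connect0. Qed.

Lemma mean_factor_total iv a v :
  mean_factor N iv a v + mean_factor N iv (flip v a) v = 1.
Proof.
rewrite /mean_factor flip_same.
have -> : \sum_(u in parents N v) weight N u v * (flip v a u)%:R =
          \sum_(u in parents N v) weight N u v * (a u)%:R.
  apply: eq_bigr => u; rewrite inE => uv; rewrite flip_other//.
  by apply: contraTneq uv => ->; exact: edge_irr.
case: ifP => _; first by case: (a v); rewrite ?addr0 ?add0r.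
case: (iv v) => [[]|]; case: (a v) => /=; rewrite ?addr0 ?add0r//; ring.
Qed.

Lemma expect1 iv : expect iv (fun=> 1) = 1.
Proof.
rewrite /expect; under eq_bigr do rewrite mul1r.
exact: (sum_prod1 acyclicN (mean_factor_local iv) (mean_factor_total iv)).
Qed.

(** Assignments with value 0 at the root have a vanishing weight. *)
Lemma expect_root iv F :
  expect iv (fun a : {ffun V -> bool} => (a (root N))%:R * F a) = expect iv F.
Proof.
apply: eq_expect => a; rewrite (bigD1 (root N))//= {1 3}/mean_factor eqxx.
by case: (a _); rewrite ?mul1r// !mul0r mulr0.
Qed.

Lemma expect_do iv v (b : bool) F : v != root N -> iv v = Some b ->
  expect iv (fun a : {ffun V -> bool} => (a v)%:R * F a) = b%:R * expect iv F.
Proof.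
move=> vr ivb; rewrite -expectZ; apply: eq_expect => a.
rewrite (bigD1 v)//= {1 3}/mean_factor (negbTE vr) ivb.
by case: eqP => [->//|_]; rewrite !mul0r !mulr0.
Qed.

(** An instance of [sum_markov] in which [p] is the linear form in the parents; by acyclicity no
    parent of [v] is reachable from [v]. *)
Lemma expect_parents iv v F : v != root N -> iv v = None ->
  ignores [set u | connect (edge N) v u] F ->
  expect iv (fun a : {ffun V -> bool} => (a v)%:R * F a) =
  \sum_(u in parents N v)
    weight N u v * expect iv (fun a : {ffun V -> bool} => (a u)%:R * F a).
Proof.
move=> vr ivv Fv.
pose p a : R := \sum_(u in parents N v) weight N u v * (a u)%:R.
rewrite /expect (sum_markov acyclicN (mean_factor_local iv) (mean_factor_total iv)
  (p := p))//.
- under [RHS]eq_bigr do rewrite mulr_sumr.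
  rewrite exchange_big; apply: eq_bigr => a _ /=.
  by rewrite /p !mulr_suml; apply: eq_bigr => u _; rewrite !mulrA.
- by move=> a; rewrite {1}/mean_factor (negbTE vr) ivv.
- move=> a b ab; apply: eq_bigr => u; rewrite inE => uv.
  by rewrite ab// inE; exact: acyclicN.
Qed.

End NetworkExpectation.

(** * Directed paths and descendants *)

Section DirectedPaths.
Context (V : finType) (e : rel V).
Hypothesis acyclic_e : forall u v, e u v -> ~~ connect e v u.

Lemma acyclic_path_uniq u p : path e u p -> uniq (u :: p).
Proof.
elim: p u => // v p IH u /= /andP[euv vp].
rewrite -[_ && uniq p]/(uniq (v :: p)) IH// andbT.
by apply: contra (acyclic_e euv); exact: path_connect.
Qed.

End DirectedPaths.

Section Descendants.
Context d (Omega : measurableType d) (R : realType) (P : probability Omega R).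
Variables (V : finType) (N : network P V).
Implicit Types u v w : V.

Lemma path_descendant u v p : path (edge N) u (rcons p v) -> descendant N u v.
Proof.
case: p => [|z p] /= /andP[uz zp]; apply/existsP.
  by exists v; rewrite uz connect0.
exists z; rewrite uz; apply/connectP; exists (rcons p v) => //.
by rewrite last_rcons.
Qed.

Lemma descendant_connect u v : descendant N u v -> connect (edge N) u v.
Proof. by case/existsP=> z /andP[uz]; apply: connect_trans; exact: connect1. Qed.

Lemma connect_descendant u v w :
  connect (edge N) u v -> descendant N v w -> descendant N u w.
Proof.
case/connectP=> -[_ -> //|z p] /= /andP[uz zp] vE vw.
apply/existsP; exists z; rewrite uz; apply: connect_trans (descendant_connect vw).
by apply/connectP; exists p.
Qed.

Lemma acyclic_descendant u v :
  acyclic N -> descendant N u v -> ~~ connect (edge N) v u.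
Proof.
move=> acN /existsP[z /andP[uz zv]].
by apply: contra (acN _ _ uz); exact: connect_trans.
Qed.

End Descendants.

Lemma big_option (T : finType) (A : Type) (idx : A) (op : Monoid.law idx)
    (Q : pred (option T)) (F : option T -> A) :
  \big[op/idx]_(u | Q u) F u =
  op (if Q None then F None else idx) (\big[op/idx]_(i | Q (Some i)) F (Some i)).
Proof.
rewrite ![index_enum _]unlock [@Finite.enum in LHS]unlock/= big_cons big_map.
by case: ifP => _ //; rewrite Monoid.mul1m.
Qed.

(** * Hidden paths *)

Section HiddenPaths.
Context d (Omega : measurableType d) (R : realType) (P : probability Omega R).
Variables (H O : finType) (G : network P (H + O)%type).
Hypothesis acyclicG : acyclic G.
Local Notation V := (H + O)%type.

(** The nodes of the path, end points included, are distinct. The strict bound leaves room to put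
    one more node in front of [q]. *)
Lemma hidden_path_size (u v : V) q :
  is_hidden_path G u v q -> (size q < #|{: V}|)%N.
Proof.
case/andP=> /(acyclic_path_uniq acyclicG)/card_uniqP/= E _.
rewrite size_rcons in E; apply: leq_trans (max_card (mem (u :: rcons q v))).
by rewrite E.
Qed.

Lemma hidden_path_cons (u v w : V) q :
  is_hidden_path G u v (w :: q) =
  [&& edge G u w, hidden w & is_hidden_path G w v q].
Proof.
by rewrite /is_hidden_path /= -!andbA; case: (edge G u w) => //=; rewrite andbCA.
Qed.

(** Unlike in [weight'], the starting node may be hidden, as the recursion along a path requires. *)
Definition hidden_path_sum (x u : V) : R :=
  \sum_(q : #|{: V}|.-bseq V | is_hidden_path G u x q)
    path_weight G u (rcons q x).

(** Paths are sorted by their first intermediate node: the direct edge has none, and the others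
    continue from a hidden successor [w]. *)
Lemma hidden_path_sum_rec x u :
  hidden_path_sum x u =
  (if edge G u x then weight G u x else 0) +
  \sum_(w | edge G u w && hidden w) weight G u w * hidden_path_sum x w.
Proof.
rewrite {1}/hidden_path_sum.
rewrite (partition_big (fun q : #|{: V}|.-bseq V => ohead q) predT)//= big_option.
congr (_ + _).
  rewrite (eq_bigl (fun q => edge G u x && (q == [bseq]))) => [|q]; last first.
    rewrite -val_eqE /=; case: (val q) => [|z s]; rewrite ?andbF//.
    by rewrite /is_hidden_path/= !andbT.
  case: ifP => _; last by rewrite big_pred0.
  by rewrite big_pred1_eq /= mulr1.
rewrite [RHS]big_mkcond; apply: eq_bigr => w _.
case: ifPn => [/andP[uw hw]|nuw]; last first.
  apply: big_pred0 => q; apply/negP => /andP[uq /eqP].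
  case: (val q) uq => // z s uzs [zw]; move: uzs.
  by rewrite zw hidden_path_cons andbA (negbTE nuw).
rewrite mulr_sumr.
(* [insub_bseq] falls back to the empty sequence when the list is too long. By [hidden_path_size]
   this never happens to the tail of a hidden path. *)
pose cons_q (q : #|{: V}|.-bseq V) : #|{: V}|.-bseq V := insub_bseq _ (w :: q).
pose tail_q (q : #|{: V}|.-bseq V) : #|{: V}|.-bseq V := insub_bseq _ (behead q).
have tailE (q : #|{: V}|.-bseq V) : val (tail_q q) = behead q.
  by rewrite val_insubd size_behead (leq_trans (leq_pred _)) ?size_bseq.
have consE (q : #|{: V}|.-bseq V) : (size q < #|{: V}|)%N -> val (cons_q q) = w :: q.
  by move=> sq; rewrite val_insubd /= sq.
have consN (q : #|{: V}|.-bseq V) : ~~ (size q < #|{: V}|)%N -> val (cons_q q) = [::].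
  by move=> sq; rewrite val_insubd /= (negbTE sq).
rewrite (reindex_onto cons_q tail_q) => [|q /andP[_ /eqP]]; last first.
  case: q => -[|z s]// sz [zw]; apply: val_inj.
  by rewrite consE tailE //= zw.
apply: eq_big => [q|q /andP[/andP[_ /eqP]]].
  have [sq|sq] := boolP (size q < #|{: V}|)%N.
    rewrite (consE _ sq) /= eqxx andbT hidden_path_cons uw hw/=.
    by rewrite -val_eqE /= tailE consE//= eqxx andbT.
  rewrite (consN _ sq) andbF; apply/esym/negP => /hidden_path_size.
  by rewrite (negbTE sq).
have [sq _ _|sq] := boolP (size q < #|{: V}|)%N; first by rewrite consE.
by rewrite consN.
Qed.

Lemma hidden_path_sum0 x u :
  (forall q, ~~ is_hidden_path G u x q) -> hidden_path_sum x u = 0.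
Proof. by move=> noq; apply: big_pred0 => q; apply/negbTE. Qed.

(* Substituting the recursion for [hidden_path_sum] into the sum over all nodes
   of [hidden_path_sum (inr x) u * m u] makes the contributions of all
   hidden nodes other than the root cancel. *)
Lemma hidden_path_expansion (u0 : H) (x : O) (m : V -> R) :
  (forall v, ~~ edge G v (inl u0)) ->
  (forall v : V, v = inr x \/
     hidden v /\ v <> inl u0 /\ (exists q, is_hidden_path G v (inr x) q) ->
     m v = \sum_(u in parents G v) weight G u v * m u) ->
  m (inr x) = hidden_path_sum (inr x) (inl u0) * m (inl u0) +
    \sum_i hidden_path_sum (inr x) (inr i) * m (inr i).
Proof.
move=> src mE; pose t := hidden_path_sum (inr x).
have E1 : \sum_u t u * m u =
    m (inr x) + \sum_(w | hidden w && (w != inl u0)) t w * m w.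
  under eq_bigr => u _ do rewrite /t hidden_path_sum_rec mulrDl mulr_suml.
  rewrite big_split/=; congr (_ + _).
    rewrite mE; last by left.
    rewrite [RHS]big_mkcond; apply: eq_bigr => u _.
    by rewrite inE; case: ifP => // _; rewrite mul0r.
  rewrite (exchange_big_dep (fun w => hidden w && (w != inl u0)))/=; last first.
    move=> u w _ /andP[uw ->] /=.
    by apply: contraTneq uw => ->; exact: src.
  apply: eq_bigr => w /andP[hw /eqP wu0].
  (* Without a hidden path from [w] to [x] no equation for [m w] is available, but then its
     coefficient is zero. *)
  have [hpw|nhp] := pselect (exists q, is_hidden_path G w (inr x) q); last first.
    have t0 : t w = 0.
      by apply: hidden_path_sum0 => q; apply/negP => ?; apply: nhp; exists q.
    by rewrite t0 mul0r big1// => u _; rewrite -/(t w) t0 mulr0 mul0r.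
  rewrite mE; last by right.
  rewrite mulr_sumr; apply: eq_big => [u|u _]; first by rewrite inE hw andbT.
  by rewrite -/(t w); ring.
move: E1; rewrite big_sumType/= [X in _ = _ + X]big_sumType/=.
rewrite [X in _ = _ + (_ + X)]big_pred0 // addr0.
rewrite (bigD1 u0)//= => E1.
have E2 : \sum_(w | inl w != inl u0 :> V) t (inl w) * m (inl w) =
          \sum_(w | w != u0) t (inl w) * m (inl w) by exact: eq_bigl.
rewrite E2 in E1; rewrite -/t; lra.
Qed.

End HiddenPaths.

(** * The transformed model *)

Section Transform.
Context d (Omega : measurableType d) (R : realType) (P : probability Omega R).
Variables (H O : finType) (G : network P (H + O)%type) (u0 : H) (y : O).
Hypothesis hG : hidden_BLM G u0 y.
Local Notation V := (H + O)%type.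
Local Notation G' := (transform G).

(** The range condition at the single assignment of all ones already confines the noise to an
    interval of length one. *)
Lemma noise_bounded v : v != inl u0 ->
  exists M : R, {ae P, forall w, `|noise G v w| <= M}.
Proof.
move=> vu0; pose a : {ffun V -> bool} := [ffun=> true].
pose c : R := \sum_(u in parents G v) weight G u v * (a u)%:R.
exists (1 + `|c|).
have := hblm_range hG vu0 (a := a); rewrite ffunE => /(_ erefl).
apply: filterS => w; rewrite /prob_one -/c ler_norml => /andP[].
have := ler_norm c; have := ler_norm (- c); rewrite normrN.
by move=> ? ? ? ?; apply/andP; split; lra.
Qed.

Lemma hidden_prob_expect iv A :
  prob G iv A = expect G iv (fun a => (a \in A)%:R).
Proof.
have rG := hblm_root hG.
rewrite probE /expect; first last.
- by move=> v; rewrite rG; exact: noise_bounded.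
- by move=> v; rewrite rG => vu0; exact: (hblm_mean hG).
- by rewrite rG; exact: hblm_indep hG.
rewrite big_mkcond; apply: eq_bigr => a _.
by case: ifP => _; rewrite ?mul1r ?mul0r.
Qed.

Lemma transform_indep :
  mutually_independent (fun v => v != None) (noise G').
Proof.
move=> J B JD mB.
pose J' := [set v : V | if v is inr i then Some i \in J else false].
pose B' (v : V) := if v is inr i then B (Some i) else setT.
have := hblm_indep hG (J := J') (B := B').
have -> : ([set w | forall v, v \in J' -> B' v (noise G v w)] =
           [set w | forall v, v \in J -> B v (noise G' v w)])%classic.
  apply/seteqP; split => w /= Hw.
    move=> [i|] vJ; last by have := JD _ vJ.
    by have := Hw (inr i); rewrite inE; apply.
  by move=> [u|i]; rewrite inE// => /Hw.
move=> ->; first last.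
- by case=> [u|i]; [exact: measurableT|exact: mB].
- by move=> [u|i]; rewrite !inE.
rewrite big_sumType/= [X in (X * _)%E]big_pred0 ?mul1e; last by move=> u; rewrite inE.
rewrite big_option; case: ifPn => [/JD//|_].
by rewrite [RHS]mul1e; apply: eq_bigl => i; rewrite inE.
Qed.

Lemma transform_prob_expect iv A :
  prob G' iv A = expect G' iv (fun a => (a \in A)%:R).
Proof.
rewrite probE /expect; first last.
- by case=> // i _; exact: noise_bounded.
- by case=> // i _; exact: (hblm_mean hG (v := inr i)).
- exact: transform_indep.
rewrite big_mkcond; apply: eq_bigr => a _.
by case: ifP => _; rewrite ?mul1r ?mul0r.
Qed.

(** An edge of [G'] between observed nodes unfolds to a directed path of [G]; acyclicity of [G']
    follows from this. *)
Lemma transform_connect v i : connect (edge G') v (Some i) ->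
  if v is Some j then connect (edge G) (inr j) (inr i) else true.
Proof.
case/connectP=> p; elim: p v => [|w p IH] v /=.
  by move=> _ <-; exact: connect0.
case/andP=> vw wp pE; have := IH w wp pE.
case: v vw => // j; case: w {wp pE} => // k /= /set0Pn[q].
rewrite inE => /andP[/path_descendant/descendant_connect jk _].
exact: connect_trans.
Qed.

Lemma transform_acyclic : acyclic G'.
Proof.
move=> u [j|]; last by case: u.
case: u => [i|] /=; last first.
  move=> _; apply/negP => /connectP[p + pE].
  by elim: p j pE => // -[k|] p IH j //= /IH IHp /andP[_ /IHp].
move=> /set0Pn[q]; rewrite inE => /andP[/path_descendant ij _].
apply/negP => /transform_connect.
exact/negP/(acyclic_descendant (hblm_acyclic hG) ij).
Qed.

Lemma weight'_Some i x :
  weight' G (Some i) (Some x) = hidden_path_sum G (inr x) (inr i).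
Proof. by apply: eq_bigl => q; rewrite inE. Qed.

(** Solving the linear equations under the intervention that sets all other observed nodes to 0
    leaves only the root term, where [m] is one. *)
Lemma weight'_None x :
  weight' G None (Some x) = hidden_path_sum G (inr x) (inl u0).
Proof.
have acG := hblm_acyclic hG; have rG := hblm_root hG.
rewrite /weight' hidden_prob_expect.
set iv := do_obs _ _.
pose m (v : V) := expect G iv (fun a : {ffun V -> bool} => (a v)%:R * 1).
rewrite (_ : expect G iv _ = m (inr x)); last first.
  by apply: eq_expect => a; rewrite inE mulr1.
rewrite (hidden_path_expansion acG (hblm_root_source hG) (m := m)) =>
    [|v vx]; last first.
  apply: expect_parents => //.
    by rewrite rG; case: vx => [->//|[_ [/eqP]]].
  by case: vx => [->|[]]; [rewrite /= !inE eqxx|case: v].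
rewrite [m (inl u0)]/m -rG expect_root expect1// mulr1 big1 ?addr0// => i _.
(* For [i = x] the coefficient vanishes by acyclicity; for the other nodes the expectation does, by
   the intervention. *)
have [->|ix] := eqVneq i x.
  rewrite hidden_path_sum0 ?mul0r// => q; apply/negP => /andP[+ _].
  by move/path_descendant/(acyclic_descendant acG); rewrite connect0.
rewrite /m (expect_do _ (b := false)) ?mul0r ?mulr0//; first by rewrite rG.
by rewrite /= !inE ix ffunE.
Qed.

(* The first observed node on a path from a hidden ancestor of [x] to [i] has [x]
   as a descendant, which admissibility excludes. *)
Lemma hidden_ancestor_parents x i (v : V) :
  v = inr x \/
    hidden v /\ v <> inl u0 /\ (exists q, is_hidden_path G v (inr x) q) ->
  edge' G (Some i) (Some x) -> ~~ connect (edge G) v (inr i).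
Proof.
move=> vx /set0Pn[q]; rewrite inE => /andP[/path_descendant ix _].
apply/negP => vi; case: vx => [vx|].
  by move: vi; apply/negP; rewrite vx; exact: acyclic_descendant (hblm_acyclic hG) ix.
case=> hv [uu0 [p px]]; case: v hv vi uu0 px => // u _ ui uu0 px.
have [j [r ur ji]] : exists j, exists2 r, is_hidden_path G (inl u) (inr j) r &
    connect (edge G) (inr j) (inr i).
  case/connectP: ui => s; elim: s u {uu0 p px} => // -[w|j] s IH u /= /andP[uw ws] sE.
    have [j [r wr ji]] := IH w ws sE; exists j, (inl w :: r) => //.
    by rewrite hidden_path_cons uw.
  exists j, [::]; first by rewrite /is_hidden_path/= uw.
  by apply/connectP; exists s.
have {}uu0 : u != u0 by apply/eqP => uE; apply: uu0; rewrite uE.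
exact: (hblm_admissible hG uu0 (connect_descendant ji ix) ur px).
Qed.

End Transform.
Theorem lemma3 (d : measure_display) (Omega : measurableType d) (R : realType)
    (P : probability Omega R) (H O : finType) (u0 : H) (y : O)
    (G : network P (H + O)%type) (hG : hidden_BLM G u0 y)
    (x : O) (S : {set O}) (hS : y \notin S)
    (pa : {ffun option O -> bool}) (hpa : pa None = true)
    (s : {ffun O -> bool})
    (hs : forall i : O, i \in S -> Some i \in parents (transform G) (Some x) ->
      s i = pa (Some i)) :
  let G' := transform G in
  let PaG := [set a : {ffun H + O -> bool} |
    [forall (i : O | Some i \in parents G' (Some x)), a (inr i) == pa (Some i)]] in
  let PaG' := [set a : {ffun option O -> bool} |
    [forall (v : option O | v \in parents G' (Some x)), a v == pa v]] in
  0 < prob G (do_obs S s) PaG ->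
  0 < prob G' (do_obs' S s) PaG' ->
  cond_prob G (do_obs S s) [set a : {ffun H + O -> bool} | a (inr x)] PaG =
  cond_prob G' (do_obs' S s) [set a : {ffun option O -> bool} | a (Some x)] PaG'.
Proof.
Proof.
move=> G' PaG PaG' PaG_gt0 PaG'_gt0.
have acG := hblm_acyclic hG; have rG := hblm_root hG.
have acG' := transform_acyclic hG.
pose F (a : {ffun H + O -> bool}) : R := (a \in PaG)%:R.
pose F' (a : {ffun option O -> bool}) : R := (a \in PaG')%:R.
pose iv := do_obs (H := H) S s; pose iv' := do_obs' S s.
have EF : prob G iv PaG = expect G iv F by exact: hidden_prob_expect hG _ _.
have EF' : prob G' iv' PaG' = expect G' iv' F' by exact: transform_prob_expect hG _ _.
have F_neq0 : expect G iv F != 0 by rewrite -EF gt_eqF.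
have F'_neq0 : expect G' iv' F' != 0 by rewrite -EF' gt_eqF.
have numE : prob G iv ([set a : {ffun H + O -> bool} | a (inr x)] :&: PaG) =
    expect G iv (fun a : {ffun H + O -> bool} => (a (inr x))%:R * F a).
  rewrite (hidden_prob_expect hG); apply: eq_expect => a.
  by rewrite /F -natrM mulnb finset.in_setI; congr ((_ && _)%:R * _); rewrite inE.
have numE' : prob G' iv' ([set a : {ffun option O -> bool} | a (Some x)] :&: PaG') =
    expect G' iv' (fun a : {ffun option O -> bool} => (a (Some x))%:R * F' a).
  rewrite (transform_prob_expect hG); apply: eq_expect => a.
  by rewrite /F' -natrM mulnb finset.in_setI; congr ((_ && _)%:R * _); rewrite inE.
rewrite /cond_prob -/iv -/iv' EF EF' numE numE'.
(* If [x] is intervened upon, both sides equal the imposed value [s x]. *)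
have [xS|xS] := boolP (x \in S).
  rewrite (expect_do _ (b := s x)) ?rG//; last by rewrite /= xS.
  rewrite (expect_do _ (b := s x))//; last by rewrite /= xS.
  by rewrite !mulfK.
(* The noise-free probability that [G'] assigns to [x] given [pa]; it is shown to be the common
   value of both quotients. *)
pose q : R := weight' G None (Some x) +
  \sum_(i | edge' G (Some i) (Some x)) weight' G (Some i) (Some x) * (pa (Some i))%:R.
suff [-> ->] :
    expect G iv (fun a : {ffun H + O -> bool} => (a (inr x))%:R * F a) =
      q * expect G iv F /\
    expect G' iv' (fun a : {ffun option O -> bool} => (a (Some x))%:R * F' a) =
      q * expect G' iv' F'.
  by rewrite !mulfK.
split.
  pose m (v : H + O) := expect G iv (fun a : {ffun H + O -> bool} => (a v)%:R * F a).
  rewrite -/(m (inr x)).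
  rewrite (hidden_path_expansion acG (hblm_root_source hG) (m := m)) =>
    [|v vx]; last first.
    apply: expect_parents => //.
    - by rewrite rG; case: vx => [->//|[_ [/eqP]]].
    - by case: vx => [->|[]]; [rewrite /= (negbTE xS)|case: v].
    (* [F] reads only the observed parents of [x] in [G'], and none of them is reachable from
       [v]. *)
    - move=> a b ab; congr (_%:R); rewrite !inE; congr nat_of_bool.
      apply: eq_forallb => i; rewrite inE; case: (boolP (edge _ _ _)) => // ix /=.
      by rewrite ab// inE (hidden_ancestor_parents hG vx).
  rewrite [m (inl u0)]/m -rG expect_root rG -(weight'_None hG) mulrDl; congr (_ + _).
  rewrite mulr_suml [RHS]big_mkcond; apply: eq_bigr => i _.
  (* A node that is not a parent of [x] in [G'] has an empty path sum; for a parent, [F] fixes its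
     value to that of [pa]. *)
  rewrite -weight'_Some; case: ifPn => [ix|/negPn/eqP no]; last first.
    by rewrite /= no big_set0 mul0r.
  rewrite -mulrA -expectZ; congr (_ * _); apply: eq_expect => a.
  rewrite /F inE; case: forallP => [/(_ i)|_]; last by rewrite !mulr0.
  by rewrite inE [edge _ _ _]ix => /eqP ->.
(* In [G'] one linear equation suffices, since [F'] fixes all parents of [x], with value 1 at the
   root by [hpa]. *)
rewrite expect_parents//; first last.
- move=> a b ab; congr (_%:R); rewrite !inE; congr nat_of_bool.
  apply: eq_forallb => v; rewrite inE; case: (boolP (edge _ _ _)) => // vx /=.
  by rewrite ab// inE; exact: acG'.
- by rewrite /= (negbTE xS).
rewrite (eq_bigr (fun v =>
    weight' G v (Some x) * (pa v)%:R * expect G' iv' F')) => [|v vx].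
  rewrite -mulr_suml; congr (_ * _).
  rewrite big_mkcond big_option inE/= hpa mulr1; congr (_ + _).
  by rewrite [RHS]big_mkcond; apply: eq_bigr => i _; rewrite inE.
rewrite -mulrA -[in RHS]expectZ; congr (_ * _); apply: eq_expect => a.
rewrite /F' inE; case: forallP => [/(_ v)|_]; last by rewrite !mulr0.
by rewrite vx => /eqP ->.
Qed.
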